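(* Let $q\in\mathbb{C}\setminus\{0\}$ be not a root of unity. There are no non-trivial transposed Poisson algebra structures on the $q$-quantum torus Lie algebra $\tilde{L(q)}$; that is, every transposed Poisson structure $\cdot$ on $\tilde{L(q)}$ satisfies $x\cdot y=0$ for all $x,y\in\tilde{L(q)}$.
   Context: ''Not a root of unity'' means $q^t\neq 1$ for all positive integers $t$. For such $q$, the $q$-quantum torus Lie algebra $\tilde{L(q)}$ is the complex Lie algebra with basis $\{x^{\mathbf m},D(\mathbf m)\mid\mathbf m\in\mathbb{Z}^2\setminus\{\mathbf 0\}\}$ and anticommutative bracket given, for $\mathbf m,\mathbf n\in\mathbb{Z}^2\setminus\{\mathbf 0\}$, by $[x^{\mathbf m},x^{\mathbf n}]=\lambda(\mathbf m,\mathbf n)x^{\mathbf m+\mathbf n}$, $[D(\mathbf m),x^{\mathbf n}]=\lambda(\mathbf m,\mathbf n)x^{\mathbf m+\mathbf n}$, $[D(\mathbf m),D(\mathbf n)]=\lambda(\mathbf m,\mathbf n)D(\mathbf m+\mathbf n)$, where $\lambda(\mathbf m,\mathbf n)=q^{m_2n_1}-q^{m_1n_2}$ for $\mathbf m=(m_1,m_2)$, $\mathbf n=(n_1,n_2)$, with the conventions that the symbols $x^{\mathbf 0}$ and $D(\mathbf 0)$ denote $0$. A transposed Poisson structure on a complex Lie algebra $(L,[\cdot,\cdot])$ is a bilinear, commutative and associative multiplication $\cdot$ on $L$ (no unit required) such that $2z\cdot[x,y]=[z\cdot x,y]+[x,z\cdot y]$ for all $x,y,z\in L$. It is trivial if $x\cdot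 y=0$ for all $x,y\in L$. *)

(* Defs.v *)
From HB Require Import structures.
From mathcomp Require Import all_boot all_order all_algebra.
From mathcomp Require Import finmap.
From mathcomp Require Import reals.
From mathcomp Require Import complex.
From mathcomp.multinomials Require Import monalg.
From mathcomp Require Import ring.

Set Implicit Arguments.
Unset Strict Implicit.
Unset Printing Implicit Defensive.

Import GRing.Theory.
Local Open Scope ring_scope.

HB.mixin Record isLieAlgebra (F : fieldType) L of GRing.Lmodule F L := {
  lie : L -> L -> L;
  lie_bilinear : bilinear_for *:%R *:%R lie;
  lie_alternating : forall x, lie x x = 0;
  lie_jacobi : forall x y z,
    lie x (lie y z) + lie y (lie z x) + lie z (lie x y) = 0
}.

#[short(type="lieAlgebraType")]
HB.structure Definition LieAlgebra (F : fieldType) :=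
  { L of GRing.Lmodule F L & isLieAlgebra F L }.

Record transposed_poisson (F : fieldType) (L : lieAlgebraType F)
    (mul : L -> L -> L) : Prop := TransposedPoisson {
  tp_bilinear : bilinear_for *:%R *:%R mul;
  tp_commutative : commutative mul;
  tp_associative : associative mul;
  tp_compatible : forall x y z : L,
    2%:R *: mul z (lie x y) = lie (mul z x) y + lie x (mul z y)
}.

Section LinearExtension.
Variables (F : fieldType) (K : choiceType) (V : lmodType F).

Definition linext (h : K -> V) (f : {malg F[K]}) : V :=
  \sum_(k <- msupp f) f@_k *: h k.

Lemma linextw (h : K -> V) (d : {fset K}) (f : {malg F[K]}) :
  (msupp f `<=` d)%fset -> linext h f = \sum_(k <- d) f@_k *: h k.
Proof.
move=> le; apply: big_fset_incl => // x _ /mcoeff_outdom ->.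
by rewrite scale0r.
Qed.

Lemma linext_is_linear h : linear (linext h).
Proof.
move=> c f g.
pose d := (msupp (c *: f + g) `|` (msupp f `|` msupp g))%fset.
rewrite !(@linextw h d) ?fsubsetUl //.
- rewrite scaler_sumr -big_split /=; apply: eq_bigr => k _.
  by rewrite mcoeffD mcoeffZ scalerDl scalerA.
- by rewrite /d fsetUA fsubsetUr.
- by rewrite /d fsetUCA fsubsetUl.
Qed.

Lemma linextU h k : linext h << k >> = h k.
Proof.
rewrite (@linextw h [fset k]%fset) ?msuppU_le //.
by rewrite big_seq_fset1 mcoeffUU scale1r.
Qed.

End LinearExtension.

Definition nzZ2 := {m : int * int | m != 0}.

(* [inl m] indexes the basis vector x^m, [inr m] the basis vector D(m). *)
Definition qtorus_index := (nzZ2 + nzZ2)%type.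

(* The proof that q is nonzero is part of the type because the Jacobi identity
   needs it. *)
Definition qtorus (F : fieldType) (q : F) (hq : q != 0) : Type :=
  {malg F[qtorus_index]}.

HB.instance Definition _ (F : fieldType) (q : F) (hq : q != 0) :=
  GRing.Lmodule.copy (qtorus hq) {malg F[qtorus_index]}.

Section QuantumTorus.
Variables (F : fieldType) (q : F) (hq : q != 0).
Local Notation L := (qtorus hq).

Definition qlambda (m n : int * int) : F := q ^ (m.2 * n.1) - q ^ (m.1 * n.2).

(* [insub] fails exactly at m = 0, so x^0 and D(0) denote 0. *)
Definition qX (m : int * int) : L :=
  if insub m is Some i then << inl i : qtorus_index >> else 0.

Definition qD (m : int * int) : L :=
  if insub m is Some i then << inr i : qtorus_index >> else 0.

(* The [inl], [inr] case is forced by [x^m, D(n)] = - [D(n), x^m]. *)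
Definition qbracket_basis (a b : qtorus_index) : L :=
  match a, b with
  | inl m, inl n => qlambda (val m) (val n) *: qX (val m + val n)
  | inr m, inl n => qlambda (val m) (val n) *: qX (val m + val n)
  | inr m, inr n => qlambda (val m) (val n) *: qD (val m + val n)
  | inl m, inr n => - (qlambda (val n) (val m) *: qX (val n + val m))
  end.

Definition qbracket (f g : L) : L :=
  linext (fun a => linext (qbracket_basis a) g) f.

Lemma qbracket_bilinear : bilinear_for *:%R *:%R qbracket.
Proof.
split=> [g c f f'|f c g g'] /=; first exact: linext_is_linear.
rewrite /qbracket /linext scaler_sumr -big_split /=; apply: eq_bigr => k _.
have := linext_is_linear (qbracket_basis k) c g g'.
by rewrite /linext => ->; rewrite scalerDr !scalerA mulrC.
Qed.

Lemma qlambdaC m n : qlambda n m = - qlambda m n.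
Proof. by rewrite /qlambda opprB ![n.1 * _]mulrC ![n.2 * _]mulrC. Qed.

Lemma qlambda0 m : qlambda 0 m = 0.
Proof. by rewrite /qlambda !mul0r subrr. Qed.

Lemma qlambdam0 m : qlambda m 0 = 0.
Proof. by rewrite qlambdaC qlambda0 oppr0. Qed.

Lemma qlambdaN m n : m + n = 0 -> qlambda m n = 0.
Proof.
move=> /eqP; rewrite addrC addr_eq0 => /eqP ->.
by rewrite /qlambda /= !mulrN [m.2 * _]mulrC subrr.
Qed.

(* [false] stands for the x^m and [true] for the D(m). *)
Definition qB (b : bool) m : L := if b then qD m else qX m.
Definition kind (a : qtorus_index) := if a is inr _ then true else false.
Definition deg (a : qtorus_index) : int * int :=
  match a with inl m => val m | inr m => val m end.

Lemma qB_index a : qB (kind a) (deg a) = << a >>.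
Proof. by case: a => m; rewrite /= /qX /qD valK. Qed.

Lemma qBP b m :
  qB b m = 0 /\ m = 0 \/
  exists a, [/\ b = kind a, m = deg a & qB b m = << a >>].
Proof.
have [->|m0] := eqVneq m 0; first by left; case: b; rewrite /= /qX /qD insubF.
right; exists (if b then inr (Sub m m0 : nzZ2) else inl (Sub m m0 : nzZ2)).
by split; case: b; rewrite //= /qX /qD insubT.
Qed.

Lemma qbracketU a b :
  qbracket << a >> << b >> =
  qlambda (deg a) (deg b) *: qB (kind a && kind b) (deg a + deg b).
Proof.
rewrite /qbracket !linextU.
case: a b => m [] n //=.
by rewrite qlambdaC scaleNr opprK addrC.
Qed.

Lemma qbracket0l g : qbracket 0 g = 0.
Proof. by rewrite /qbracket /linext msupp0 big_nil. Qed.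

Lemma qbracket0r f : qbracket f 0 = 0.
Proof.
rewrite /qbracket /linext big1 // => k _.
by rewrite msupp0 big_nil scaler0.
Qed.

Lemma qbracketB b c m n :
  qbracket (qB b m) (qB c n) = qlambda m n *: qB (b && c) (m + n).
Proof.
case: (qBP b m) => [[-> ->]|[a [-> -> ->]]].
  by rewrite qbracket0l qlambda0 scale0r.
case: (qBP c n) => [[-> ->]|[a' [-> -> ->]]].
  by rewrite qbracket0r qlambdam0 scale0r.
exact: qbracketU.
Qed.

Lemma qbracketXX m n : qbracket (qX m) (qX n) = qlambda m n *: qX (m + n).
Proof. exact: (qbracketB false false). Qed.

Lemma qbracketDX m n : qbracket (qD m) (qX n) = qlambda m n *: qX (m + n).
Proof. exact: (qbracketB true false). Qed.

Lemma qbracketDD m n : qbracket (qD m) (qD n) = qlambda m n *: qD (m + n).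
Proof. exact: (qbracketB true true). Qed.

Lemma qlambda_jacobi m n p :
  qlambda n p * qlambda m (n + p) + qlambda p m * qlambda n (p + m)
  + qlambda m n * qlambda p (m + n) = 0.
Proof.
rewrite /qlambda /= !mulrDr !expfzDr //.
rewrite [n.2 * m.1]mulrC [n.2 * p.1]mulrC [p.2 * m.1]mulrC.
rewrite [m.2 * n.1]mulrC [m.2 * p.1]mulrC [p.2 * n.1]mulrC.
ring.
Qed.

Lemma qbracketDl f f' g : qbracket (f + f') g = qbracket f g + qbracket f' g.
Proof. by have := qbracket_bilinear.1 g 1 f f'; rewrite /= !scale1r. Qed.

Lemma qbracketDr f g g' : qbracket f (g + g') = qbracket f g + qbracket f g'.
Proof. by have := qbracket_bilinear.2 f 1 g g'; rewrite /= !scale1r. Qed.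

Lemma qbracketZl c f g : qbracket (c *: f) g = c *: qbracket f g.
Proof. by have := qbracket_bilinear.1 g c f 0; rewrite /= !addr0 qbracket0l addr0. Qed.

Lemma qbracketZr c f g : qbracket f (c *: g) = c *: qbracket f g.
Proof. by have := qbracket_bilinear.2 f c g 0; rewrite /= !addr0 qbracket0r addr0. Qed.

Lemma qtorus_ind (P : L -> Prop) :
  P 0 -> (forall c b m f, P f -> P (c *: qB b m + f)) -> forall f, P f.
Proof.
move=> P0 PS f; rewrite [f](@monalgE qtorus_index F).
elim: (enum_fset _) => [|k s IH]; first by rewrite big_nil.
rewrite big_cons; have := PS f@_k (kind k) (deg k) _ IH; rewrite qB_index.
congr (P (_ + _)); apply/(@malgP qtorus_index F) => j.
by rewrite mcoeffZ !mcoeffU mulrnAr mulr1.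
Qed.

Lemma qbracket_anti f g : qbracket f g = - qbracket g f.
Proof.
elim/qtorus_ind: f => [|c b m f IH]; first by rewrite qbracket0l qbracket0r oppr0.
rewrite qbracketDl qbracketDr {}IH opprD; congr (_ + _).
rewrite qbracketZl qbracketZr -scalerN; congr (_ *: _).
elim/qtorus_ind: g => [|c' b' n g IHg]; first by rewrite qbracket0l qbracket0r oppr0.
rewrite qbracketDl qbracketDr IHg opprD; congr (_ + _).
rewrite qbracketZl qbracketZr -scalerN; congr (_ *: _).
by rewrite !qbracketB qlambdaC scaleNr andbC addrC.
Qed.

Lemma qbracket_alternating f : qbracket f f = 0.
Proof.
elim/qtorus_ind: f => [|c b m f IH]; first exact: qbracket0l.
rewrite qbracketDl !qbracketDr IH addr0 [X in _ + X]qbracket_anti addrK.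
by rewrite qbracketZl qbracketZr qbracketB /qlambda mulrC subrr scale0r !scaler0.
Qed.

Lemma qbracket_jacobi f g h :
  qbracket f (qbracket g h) + qbracket g (qbracket h f)
  + qbracket h (qbracket f g) = 0.
Proof.
have aux (V : lmodType F) (c : F) (x x' y y' z z' : V) :
  x + y + z = 0 -> x' + y' + z' = 0 ->
  (c *: x + x') + (c *: y + y') + (c *: z + z') = 0.
  move=> e e'; rewrite (addrACA (c *: x)) (addrACA _ _ (c *: z)) -!scalerDr e e'.
  by rewrite scaler0 addr0.
elim/qtorus_ind: f => [|c b m f IH].
  by rewrite !(qbracket0l, qbracket0r) !addr0.
rewrite !(qbracketDl, qbracketDr, qbracketZl, qbracketZr); apply: (aux) IH.
elim/qtorus_ind: g => [|c' b' n g IH].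
  by rewrite !(qbracket0l, qbracket0r) !addr0.
rewrite !(qbracketDl, qbracketDr, qbracketZl, qbracketZr); apply: (aux) IH.
elim/qtorus_ind: h => [|c'' b'' p h IH].
  by rewrite !(qbracket0l, qbracket0r) !addr0.
rewrite !(qbracketDl, qbracketDr, qbracketZl, qbracketZr); apply: (aux) IH.
rewrite !(qbracketB, qbracketZr) !scalerA.
rewrite [b' && (b'' && b)]andbCA [b'' && (b && b')]andbC -!andbA.
have -> : (b'' && (b' && b)) = [&& b, b' & b''] by case: b b' b'' => [] [] [].
rewrite [n + (p + m)]addrA [n + p + m]addrC [p + (m + n)]addrC -[m + n + p]addrA.
by rewrite -!scalerDl qlambda_jacobi scale0r.
Qed.

HB.instance Definition _ := isLieAlgebra.Build F (qtorus hq)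
  qbracket_bilinear qbracket_alternating qbracket_jacobi.

End QuantumTorus.

(* Main.v *)
Require Import Defs.
From mathcomp Require Import all_boot all_order all_algebra.
From mathcomp Require Import reals complex.
From mathcomp Require Import monalg ring zify.

Set Implicit Arguments.
Unset Strict Implicit.
Unset Printing Implicit Defensive.

Import GRing.Theory.
Local Open Scope ring_scope.
Local Open Scope complex_scope.

(** Put E(m) = D(m) - x^m.  The bracket relations say that E(m) commutes with
    every x^n and that the E(m) multiply among themselves like the x^m, so the
    Lie algebra is the sum of two commuting ideals isomorphic to the quantum
    torus algebra g with [x^m, x^n] = lambda(m, n) x^(m+n).

    For a transposed Poisson product, multiplication by a fixed z is a
    half-derivation phi, that is 2 phi[x, y] = [phi x, y] + [x, phi y].  Such a
    phi preserves both ideals: apply it to the zero bracket of an element of one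
    ideal with an element of the other, and use that g has no centre
    ([half_derivation_ideal]).

    On g, a half-derivation is diagonal in the basis x^m.  If a(m) denotes the
    coefficient of x^(m+k) in phi(x^m), then
      2 lambda(m, n) a(m+n) = lambda(m+k, n) a(m) + lambda(m, n+k) a(n).
    For k nonzero, taking n = k and n = -k gives recursions along the line
    m + Zk which contradict each other unless a vanishes ([shift_eq0]).

    So the product of two basis vectors u and v is a multiple of v, and by
    commutativity also a multiple of u; it can be nonzero only for u = v.
    Finally the equation above with k = 0, read for multiplication by x^m and
    for a splitting m = m' + m'' into non-parallel vectors, writes the
    coefficient of x^m in x^m x^m in terms of those of x^m x^m' and x^m x^m'',
    which are zero.  Besides the 2 of the defining identity, the argument divides
    by 3 = 4 - 1, which comes from the two recursions along m + Zk. *)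

(** * Coordinates adapted to the two commuting ideals *)

Section QuantumTorusCoordinates.
Variables (F : fieldType) (q : F) (hq : q != 0).
Local Notation L := (qtorus hq).
Local Notation lam := (qlambda q).
Local Notation br := (@qbracket F q hq).
Implicit Types (m n p k : int * int) (i j b : bool) (f g : L).

(** For [i = false] the basis vectors x^m of the first ideal, and for [i = true]
    the vectors E(m) of the second one. *)
Definition ideal_basis i m : L := if i then qD hq m - qX hq m else qX hq m.

(** The coordinate along [ideal_basis i p].  Since D(p) = x^p + E(p), a basis
    vector of degree p contributes to the x^p coordinate whether it is x^p or
    D(p), and to the E(p) coordinate only if it is D(p). *)
Definition coord i p (f : L) : F :=
  linext (fun a => ((deg a == p) && (i ==> kind a))%:R : F^o) f.

Lemma coord_linear i p : linear_for *%R (coord i p).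
Proof. by move=> c f g; rewrite /coord linext_is_linear. Qed.

Lemma coordD i p f g : coord i p (f + g) = coord i p f + coord i p g.
Proof. by have := coord_linear i p 1 f g; rewrite scale1r mul1r. Qed.

Lemma coord0 i p : coord i p 0 = 0.
Proof. by rewrite /coord /linext msupp0 big_nil. Qed.

Lemma coordZ i p c f : coord i p (c *: f) = c * coord i p f.
Proof. by have := coord_linear i p c f 0; rewrite !addr0 coord0 addr0. Qed.

Lemma coordN i p f : coord i p (- f) = - coord i p f.
Proof. by rewrite -scaleN1r coordZ mulN1r. Qed.

Lemma coordB i p f g : coord i p (f - g) = coord i p f - coord i p g.
Proof. by rewrite coordD coordN. Qed.

Lemma coord_qB i p b m :
  coord i p (qB hq b m) = [&& m != 0, m == p & i ==> b]%:R.
Proof.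
have [-> | m0 /=] := eqVneq m 0.
  by case: b; rewrite /= /qX /qD insubF //= coord0.
by case: b; rewrite /= /qX /qD insubT /= /coord linextU.
Qed.

Lemma coord_qX i p m : coord i p (qX hq m) = [&& m != 0, m == p & ~~ i]%:R.
Proof. by have := coord_qB i p false m; rewrite implybF. Qed.

Lemma coord_qD i p m : coord i p (qD hq m) = ((m != 0) && (m == p))%:R.
Proof. by have := coord_qB i p true m; rewrite implybT andbT. Qed.

(** No basis vector has degree 0.  This lets the recursion on the coordinates of
    a half-derivation hold for all degrees. *)
Lemma coord_at0 i f : coord i 0 f = 0.
Proof.
elim/qtorus_ind: f => [|c b m f IH]; first exact: coord0.
by rewrite coordD IH coordZ coord_qB andbA andNb andFb mulr0 addr0.
Qed.

(** As D(p) = x^p + E(p), the coefficient of x^p in the original basis is the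
    difference of the two coordinates of degree p. *)
Lemma mcoeff_coord b (u : nzZ2) f :
  (f : {malg F[qtorus_index]})@_(if b then inr u else inl u)
  = coord b (val u) f - (~~ b)%:R * coord true (val u) f.
Proof.
elim/qtorus_ind: f => [|c b' m f IH].
  by rewrite (@mcoeff0 qtorus_index F) !coord0 mulr0 subrr.
rewrite (@mcoeffD qtorus_index F) (@mcoeffZ qtorus_index F) IH {IH} !coordD !coordZ !coord_qB.
case: (qBP hq b' m) => [[-> ->]|[a [-> -> ->]]].
  by rewrite (@mcoeff0 qtorus_index F) eqxx /=; ring.
rewrite mcoeffU.
have deg0 : deg a != 0 by case: a => v; exact: (valP v).
have inl_inr v : (inl v == inr u :> qtorus_index) = false by [].
have inr_inl v : (inr v == inl u :> qtorus_index) = false by [].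
have inl_inl v : (inl v == inl u :> qtorus_index) = (v == u) by [].
have inr_inr v : (inr v == inr u :> qtorus_index) = (v == u) by [].
rewrite deg0 /=; case: a {deg0} => v; rewrite /= val_eqE; case: b;
  rewrite /= ?inl_inr ?inr_inl ?inl_inl ?inr_inr ?andbT ?andbF mulr0n /=; ring.
Qed.

Lemma coord_inj f : (forall i p, coord i p f = 0) -> f = 0.
Proof.
move=> f0; apply/(@malgP qtorus_index F) => -[u|u]; rewrite (@mcoeff0 qtorus_index F).
  by have := mcoeff_coord false u f; rewrite !f0 mulr0 subrr.
by have := mcoeff_coord true u f; rewrite !f0 mulr0 subrr.
Qed.

Lemma qbracketBr f g h : br f (g - h) = br f g - br f h.
Proof. by rewrite qbracketDr -[- h]scaleN1r qbracketZr scaleN1r. Qed.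

Lemma qbracketBl f g h : br (f - g) h = br f h - br g h.
Proof. by rewrite qbracketDl -[- g]scaleN1r qbracketZl scaleN1r. Qed.

Lemma coord_ideal_basis i p j m :
  coord i p (ideal_basis j m) = [&& i == j, m != 0 & m == p]%:R.
Proof.
case: j; rewrite /ideal_basis.
  transitivity (((m != 0) && (m == p))%:R - [&& m != 0, m == p & ~~ i]%:R : F).
    by rewrite coordB; congr (_ - _); [exact: coord_qD | exact: coord_qX].
  by case: i (_ != 0) (_ == p) => [] [] []; rewrite /= ?subr0 ?subrr.
by rewrite coord_qX; case: i (_ != 0) (_ == p) => [] [] [].
Qed.

Lemma qbracket_qB_ideal b m j n :
  br (qB hq b m) (ideal_basis j n) =
  (lam m n * (j ==> b)%:R) *: ideal_basis j (m + n).
Proof.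
have hX := qbracketB hq b false m n; rewrite andbF /= in hX.
have hD := qbracketB hq b true m n; rewrite andbT /= in hD.
case: j; rewrite /ideal_basis; last by rewrite /= mulr1; exact: hX.
transitivity (lam m n *: qB hq b (m + n) - lam m n *: qX hq (m + n)).
  by rewrite qbracketBr; congr (_ - _).
case: b {hX hD}; first by rewrite mulr1 scalerBr.
by rewrite mulr0 scale0r subrr.
Qed.

Lemma qbracket_ideal_basis i m j n :
  br (ideal_basis i m) (ideal_basis j n) =
  ((i == j)%:R * lam m n) *: ideal_basis j (m + n).
Proof.
have hX := qbracket_qB_ideal false m j n.
have hD := qbracket_qB_ideal true m j n.
case: i; rewrite {1}/ideal_basis.
  transitivity ((lam m n * (j ==> true)%:R - lam m n * (j ==> false)%:R)
                *: ideal_basis j (m + n)).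
    by rewrite qbracketBl scalerBl; congr (_ - _).
  by congr (_ *: _); case: j {hX hD} => /=; ring.
transitivity ((lam m n * (j ==> false)%:R) *: ideal_basis j (m + n)).
  exact: hX.
by congr (_ *: _); case: j {hX hD} => /=; ring.
Qed.

(** The reason for these coordinates: bracketing with a basis vector of the
    ideal j kills the coordinates along the other ideal, and shifts those along
    j. *)
Lemma coord_bracket i p j n f :
  coord i p (br f (ideal_basis j n))
  = (i == j)%:R * lam (p - n) n * coord i (p - n) f.
Proof.
elim/qtorus_ind: f => [|c b m f IH].
  by rewrite qbracket0l !coord0 mulr0.
rewrite qbracketDl !coordD qbracketZl !coordZ mulrDr IH; congr (_ + _).
rewrite mulrCA; congr (_ * _) => {IH f c}.
rewrite qbracket_qB_ideal coordZ coord_ideal_basis coord_qB.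
have [<-|_] := eqVneq i j; last by rewrite /= mulr0 !mul0r.
have [e|ne] := eqVneq m (p - n); last first.
  have -> : (m + n == p) = false.
    by apply/eqP => e; case/eqP: ne; rewrite -e addrK.
  by rewrite !andbF !mulr0.
rewrite {}e subrK !eqxx !andbT mul1r -mulrA -natrM mulnb.
have [-> | p0] := eqVneq p 0.
  by rewrite sub0r qlambdaN ?addNr // !mul0r.
have [-> | pn0] := eqVneq (p - n) 0; first by rewrite qlambda0 !mul0r.
by rewrite /= andbT.
Qed.

Lemma coord_bracketl i p j n f :
  coord i p (br (ideal_basis j n) f)
  = (i == j)%:R * lam n (p - n) * coord i (p - n) f.
Proof.
by rewrite qbracket_anti coordN coord_bracket (qlambdaC q (p - n)); ring.
Qed.

End QuantumTorusCoordinates.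

(** * The structure constants and their shifted recursion *)

Section StructureConstants.
Variables (F : fieldType) (q : F).
Hypotheses (hq : q != 0) (q_not_root : forall t : nat, (0 < t)%N -> q ^+ t != 1).
Local Notation lam := (qlambda q).
Implicit Types (m n p k : int * int).

Lemma exprz_eq1 (z : int) : q ^ z = 1 -> z = 0.
Proof.
case: z => [[|t]|t] // e; case/eqP: (q_not_root (ltn0Sn t)) => //.
by apply: invr_inj; rewrite invr1 -e NegzE exprnN.
Qed.

(** As q is not a root of unity, lambda(m, n) detects whether m and n are
    parallel. *)
Lemma qlambda_eq0 m n : (lam m n == 0) = (m.2 * n.1 == m.1 * n.2).
Proof.
apply/eqP/eqP => [/eqP|e]; last by rewrite /qlambda e subrr.
rewrite /qlambda subr_eq0 => /eqP e.
apply/eqP; rewrite -subr_eq0; apply/eqP/exprz_eq1.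
by rewrite expfzDr // -invr_expz e divff // expfz_neq0.
Qed.

Definition perp m : int * int := (- m.2, m.1).

Lemma qlambda_perp_neq0 m : m != 0 -> lam m (perp m) != 0.
Proof.
apply: contra; rewrite qlambda_eq0 -pair_eqE /pair_eq /= => /eqP e.
by apply/andP; split; apply/eqP; nia.
Qed.

Lemma qlambda_perp_parallel_neq0 m k :
  m != 0 -> k != 0 -> lam m k = 0 -> lam (perp m) k != 0.
Proof.
move=> m0 k0 /eqP; rewrite qlambda_eq0 => /eqP mk; apply/negP.
rewrite qlambda_eq0 /= => /eqP e.
(* (perp m, m) is an orthogonal basis: a vector parallel to both is 0. *)
have e1 : (m.1 ^+ 2 + m.2 ^+ 2) * k.1 = 0.
  transitivity (m.1 * (m.1 * k.1 - - m.2 * k.2) + m.2 * (m.2 * k.1 - m.1 * k.2)); first by ring.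
  by rewrite e mk !subrr !mulr0 addr0.
have e2 : (m.1 ^+ 2 + m.2 ^+ 2) * k.2 = 0.
  transitivity (m.2 * (m.1 * k.1 - - m.2 * k.2) - m.1 * (m.2 * k.1 - m.1 * k.2)); first by ring.
  by rewrite e mk !subrr !mulr0 subrr.
have nm : m.1 ^+ 2 + m.2 ^+ 2 != 0.
  apply: contraNneq m0 => h; rewrite -pair_eqE /pair_eq /=.
  by apply/andP; split; apply/eqP; nia.
move: e1 e2 => /eqP; rewrite mulf_eq0 (negPf nm) /= => /eqP k1 /eqP.
rewrite mulf_eq0 (negPf nm) /= => /eqP k2.
by case/negP: k0; rewrite -pair_eqE /pair_eq /= k1 k2.
Qed.

Hypotheses (char_neq2 : 2%:R != 0 :> F) (char_neq3 : 3%:R != 0 :> F).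

(** In this section [a m] plays the role of the coefficient of x^(m+k) in
    phi(x^m), for a half-derivation phi of the quantum torus algebra. *)
Section ShiftedSolution.
Variables (k : int * int) (a : int * int -> F).
Hypothesis k0 : k != 0.
Hypothesis ha : forall m n,
  2%:R * lam m n * a (m + n) = lam (m + k) n * a m + lam m (n + k) * a n.

Local Notation U m := (q ^ (m.2 * k.1)).
Local Notation V m := (q ^ (m.1 * k.2)).
Local Notation Q := (q ^ (k.1 * k.2)).

Lemma shiftU m : U (m + k) = U m * Q.
Proof. by rewrite /= mulrDl expfzDr // [k.2 * _]mulrC. Qed.

Lemma shiftV m : V (m + k) = V m * Q.
Proof. by rewrite /= mulrDl expfzDr. Qed.

(** The equation at (m + k, -k): its last term carries lambda(m + k, 0) = 0, so
    that [a] is geometric along m + Zk, with ratio 2 Q. *)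
Lemma shift_double m : lam m k != 0 -> a (m + k) = 2%:R * Q * a m.
Proof.
move=> mk; have := ha (m + k) (- k).
rewrite addrK addNr qlambdam0 mul0r addr0.
have lamN n : lam n (- k) = (U n)^-1 - (V n)^-1.
  by rewrite /qlambda /= !mulrN -!invr_expz.
rewrite !lamN !shiftU !shiftV.
have hU : U m != 0 by rewrite expfz_neq0.
have hV : V m != 0 by rewrite expfz_neq0.
have hQ : Q != 0 by rewrite expfz_neq0.
move: mk; rewrite /qlambda -oppr_eq0 opprB => UV.
move: (U m) (V m) Q hU hV hQ UV => u v t u0 v0 t0 uv e.
apply: (mulfI uv).
transitivity (u * v * t ^+ 2 * (((u * t * t)^-1 - (v * t * t)^-1) * a (m + k))).
  by field; rewrite u0 v0 t0.
by rewrite -e; field; rewrite u0 v0 t0.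
Qed.

(** The equation at (m, k), where [a (m + k)] is eliminated by the previous
    recursion. *)
Lemma shift_from_k m : lam m k != 0 -> 3%:R * Q * a m = (U m + V m) * a k.
Proof.
move=> mk; have := ha m k; rewrite shift_double // => e.
apply: (mulfI mk); move: e.
have -> : lam m (k + k) = (U m - V m) * (U m + V m).
  by rewrite /qlambda /= !mulrDr !expfzDr //; ring.
rewrite {2}/qlambda shiftU shiftV /qlambda.
move: (U m) (V m) Q => u v t e.
transitivity (2%:R * (u - v) * (2%:R * t * a m) - (u * t - v * t) * a m); first by ring.
by rewrite e; ring.
Qed.

(** The right-hand side of [shift_from_k] is multiplied by Q when m becomes
    m + k, whereas [shift_double] multiplies its left-hand side by 2 Q. *)
Lemma shift_transverse_eq0 m : lam m k != 0 -> a m = 0.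
Proof.
move=> mk.
have hQ : Q != 0 by rewrite expfz_neq0.
have mkk : lam (m + k) k != 0.
  by rewrite /qlambda shiftU shiftV -mulrBl mulf_neq0.
have := shift_from_k mkk; rewrite shift_double // shiftU shiftV.
have := shift_from_k mk.
move: (U m) (V m) Q hQ => u v t t0 e1 e2.
have : 3%:R * t ^+ 2 * a m = 0.
  transitivity (3%:R * t * (2%:R * t * a m) - t * (3%:R * t * a m)); first by ring.
  by rewrite e1 e2; ring.
by move/eqP; rewrite !mulf_eq0 (negPf char_neq3) !(negPf t0) /= => /eqP.
Qed.

(** For nonzero m parallel to k, split m as perp m plus m - perp m, neither of
    which is parallel to k.  The vector 0 has no splitting into non-parallel
    vectors, but there the equation at (0, perp k) applies. *)
Lemma shift_eq0 m : a m = 0.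
Proof.
have [->|m0] := eqVneq m 0.
  have := ha 0 (perp k); rewrite !qlambda0 mulr0 !mul0r addr0 add0r => /esym /eqP.
  by rewrite mulf_eq0 (negPf (qlambda_perp_neq0 k0)) => /eqP.
have [mk|] := eqVneq (lam m k) 0; last exact: shift_transverse_eq0.
have pk := qlambda_perp_parallel_neq0 m0 k0 mk.
have e := ha (perp m) (m - perp m).
rewrite [perp m + _]addrC subrK in e.
have mpk : lam (m - perp m) k != 0.
  move/eqP: mk pk; rewrite !qlambda_eq0 /= !mulrDl => /eqP -> pk.
  apply: contra pk => /eqP h; apply/eqP; lia.
rewrite (shift_transverse_eq0 pk) (shift_transverse_eq0 mpk) !mulr0 addr0 in e.
have pm : lam (perp m) (m - perp m) != 0.
  have := qlambda_perp_neq0 m0; rewrite !qlambda_eq0 /=; apply: contra => /eqP h.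
  by apply/eqP; lia.
by move/eqP: e; rewrite !mulf_eq0 (negPf char_neq2) (negPf pm) /= => /eqP.
Qed.
End ShiftedSolution.
End StructureConstants.

(** * Half-derivations and the vanishing of the product *)

Section HalfDerivations.
Variables (F : fieldType) (q : F) (hq : q != 0).
Hypotheses (q_not_root : forall t : nat, (0 < t)%N -> q ^+ t != 1).
Hypotheses (char_neq2 : 2%:R != 0 :> F) (char_neq3 : 3%:R != 0 :> F).
Local Notation L := (qtorus hq).
Local Notation lam := (qlambda q).
Local Notation br := (@qbracket F q hq).
Local Notation e := (ideal_basis hq).
Implicit Types (m n p : int * int) (i j : bool) (f g : L).

Section OneHalfDerivation.
Variable phi : L -> L.
Hypothesis phiZ : forall c f, phi (c *: f) = c *: phi f.
Hypothesis phi_half : forall f g,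
  2%:R *: phi (br f g) = br (phi f) g + br f (phi g).

Lemma half_derivation0 : phi 0 = 0.
Proof. by rewrite -(scale0r (0 : L)) phiZ !scale0r. Qed.

(** [phi (e i m)] commutes with the ideal j up to an element of the ideal i; so
    its component in the ideal j is central there, and the bracket with
    [e j (perp p)] detects its coordinate at p. *)
Lemma half_derivation_ideal i j m p : i != j -> coord j p (phi (e i m)) = 0.
Proof.
move=> ij; have [->|p0] := eqVneq p 0; first exact: coord_at0.
have := phi_half (e i m) (e j (perp p)).
rewrite qbracket_ideal_basis (negPf ij) mul0r scale0r half_derivation0 scaler0.
move/(congr1 (coord j (p + perp p))).
rewrite coordD coord0 coord_bracket coord_bracketl eqxx eq_sym (negPf ij) addrK.
rewrite mul1r !mul0r addr0 => /esym /eqP.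
by rewrite mulf_eq0 (negPf (qlambda_perp_neq0 hq q_not_root p0)) => /eqP.
Qed.

(** This is the recursion solved by [shift_eq0], with p = m + n + k. *)
Lemma half_derivation_coord i m n p :
  2%:R * lam m n * coord i p (phi (e i (m + n))) =
  lam (p - n) n * coord i (p - n) (phi (e i m)) +
  lam m (p - m) * coord i (p - m) (phi (e i n)).
Proof.
have := congr1 (coord i p) (phi_half (e i m) (e i n)).
rewrite coordD coord_bracket coord_bracketl qbracket_ideal_basis phiZ.
by rewrite !coordZ eqxx !mul1r mulrA.
Qed.

Lemma half_derivation_homogeneous i m p : p != m -> coord i p (phi (e i m)) = 0.
Proof.
move=> pm; have [k k0 ->] : exists2 k, k != 0 & p = m + k.
  by exists (p - m); rewrite ?subr_eq0 // addrC subrK.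
pose a n := coord i (n + k) (phi (e i n)).
apply: (@shift_eq0 F q hq q_not_root char_neq2 char_neq3 k a k0) => {pm} {}m n.
have := half_derivation_coord i m n (m + n + k).
have -> : m + n + k - n = m + k by rewrite addrAC addrK.
by have -> : m + n + k - m = n + k by rewrite addrAC [m + n]addrC addrK addrC.
Qed.

(** The diagonal coefficients of a half-derivation satisfy 2 a(m+n) = a(m) + a(n)
    for non-parallel m and n, so that their zeros propagate. *)
Lemma half_derivation_diag i m n : lam m n != 0 ->
  coord i m (phi (e i m)) = 0 -> coord i n (phi (e i n)) = 0 ->
  coord i (m + n) (phi (e i (m + n))) = 0.
Proof.
move=> mn am an; have := half_derivation_coord i m n (m + n).
rewrite addrK [m + n - m]addrC addKr am an !mulr0 addr0 => /eqP.
by rewrite !mulf_eq0 (negPf char_neq2) (negPf mn) => /eqP.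
Qed.

End OneHalfDerivation.

(** Each factor of a product of basis vectors acts diagonally on the other one,
    which settles the case of distinct factors by commutativity; the square of
    e i m is reduced to that case by splitting one of its factors. *)
Lemma qtorus_transposed_poisson_trivial (mul : L -> L -> L) :
  transposed_poisson mul -> forall f g, mul f g = 0.
Proof.
case=> -[mull mulr] mulC _ mul_half.
have mulDr f g h : mul f (g + h) = mul f g + mul f h.
  by have := mulr f 1 g h; rewrite /= !scale1r.
have mul0r f : mul f 0 = 0.
  by have := mulr f (-1) 0 0; rewrite /= !scaleN1r !oppr0 addr0 addNr.
have mulZr f c g : mul f (c *: g) = c *: mul f g.
  by have := mulr f c g 0; rewrite /= !addr0 mul0r addr0.
have half h : forall f g, 2%:R *: mul h (br f g) = br (mul h f) g + br f (mul h g).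
  by move=> f g; exact: mul_half.
have transverse i m n l p : m != n -> coord l p (mul (e i m) (e i n)) = 0.
  move=> mn.
  have [<-{l}|il] := eqVneq i l; last exact: half_derivation_ideal.
  have [->|pn] := eqVneq p n; last exact: half_derivation_homogeneous.
  by rewrite mulC; apply: half_derivation_homogeneous; rewrite // eq_sym.
have basis0 i m j n : mul (e i m) (e j n) = 0.
  apply: coord_inj => l p.
  have [ij|ij] := eqVneq i j; last first.
    have [jl|jl] := eqVneq j l; last exact: half_derivation_ideal.
    by rewrite mulC; apply: half_derivation_ideal => //; rewrite -jl.
  rewrite -{j}ij.
  have [<-{n}|mn] := eqVneq m n; last exact: transverse.
  have [<-{l}|il] := eqVneq i l; last exact: half_derivation_ideal.
  have [->{p}|pm] := eqVneq p m; last exact: half_derivation_homogeneous.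
  have [->|m0] := eqVneq m 0; first exact: coord_at0.
  (* The operator is multiplication by e i m; only the m of its argument and
     the m of the coordinate are split. *)
  have mE : m = perp m + (m - perp m) by rewrite addrC subrK.
  have pm : perp m != m.
    apply: contraTneq (qlambda_perp_neq0 hq q_not_root m0) => ->.
    by rewrite negbK /qlambda mulrC subrr.
  have dm : m - perp m != m.
    rewrite -subr_eq0 addrAC subrr sub0r oppr_eq0.
    apply: contraTneq (qlambda_perp_neq0 hq q_not_root m0) => ->.
    by rewrite negbK qlambdam0.
  rewrite {1 3}mE; apply: half_derivation_diag => //.
  - have := qlambda_perp_neq0 hq q_not_root m0.
    rewrite !(qlambda_eq0 hq q_not_root) /=; apply: contra => /eqP h.
    by apply/eqP; lia.
  - by apply: transverse; rewrite eq_sym.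
  - by apply: transverse; rewrite eq_sym.
have spanned (P : L -> Prop) : P 0 -> (forall c i m f, P f -> P (c *: e i m + f)) ->
    forall f, P f.
  move=> P0 PS; elim/qtorus_ind => [//|c b m f Pf].
  case: b; last exact: (PS c false).
  have -> : qB hq true m = e true m + e false m by rewrite /ideal_basis subrK.
  by rewrite scalerDr -addrA; apply: (PS); apply: (PS).
move=> f g; elim/spanned: g => [//|c j n g IH].
rewrite mulDr mulZr {}IH addr0.
elim/spanned: f => [|c' i m f IH]; first by rewrite mulC mul0r scaler0.
by rewrite mulC mulDr mulZr basis0 scaler0 add0r mulC.
Qed.

End HalfDerivations.

Theorem theorem4p2 (R : realType) (q : R[i]) (hq : q != 0)
    (q_not_root : forall t : nat, (0 < t)%N -> q ^+ t != 1)
    (mul : qtorus hq -> qtorus hq -> qtorus hq) :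
  transposed_poisson mul -> forall x y : qtorus hq, mul x y = 0.
Proof.
move=> hmul; apply: (@qtorus_transposed_poisson_trivial _ q hq q_not_root _ _ mul hmul);
  by rewrite Num.Theory.pnatr_eq0.
Qed.
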